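(* Provided that the two definitions of the simplicial $d$-polytopic derivative are equivalent, i.e. provided that $\mathrm{D}_{S_d}=\mathrm{D}_{S'_d}$, where $$\mathrm{D}_{S_d}f(x)=\sum_{k=0}^{d-1}\binom{d-1}{k}\frac{1}{(k+1)!}X^{k}\mathrm{D}^{k+1}f(x)\qquad\text{and}\qquad \mathrm{D}_{S'_d}f(x)=\frac{1}{d!}\sum_{k=0}^{d}\left[{d\atop k}\right]X^{-1}(X\mathrm{D})^k f(x),$$ one has $$ {}_{1}F_{1}(1-d;2;-x)=\frac{x^{-1}}{d!}\sum_{k=0}^{d}\left[{d\atop k}\right]\mathrm{T}_k(x).$$
   Context: Here $d\ge 1$ is an integer, $\mathrm{D}=\frac{d}{dx}$ is the ordinary derivative, $X$ is the operator of multiplication by $x$ and $X^{-1}$ that of multiplication by $x^{-1}$. Both operators $\mathrm{D}_{S_d}$ and $\mathrm{D}_{S'_d}$ are defined on $d$ times continuously differentiable functions $f$. ${}_{1}F_{1}(a;b;z)=\sum_{n\ge 0}\frac{a(a+1)\cdots(a+n-1)}{b(b+1)\cdots(b+n-1)}\frac{z^n}{n!}$ is the Kummer confluent hypergeometric function. $\left[{d\atop k}\right]$ denotes the (unsigned) Stirling numbers of the first kind, determined by $x(x+1)\cdots(x+d-1)=\sum_{k=0}^{d}\left[{d\atop k}\right]x^k$. $\mathrm{T}_k(x)=\sum_{i=0}^{k}\left\{{k\atop i}\right\}x^i$ is the Touchard polynomial of degree $k$, where $\left\{{k\atop i}\right\}$ are the Stirling numbers of the second kind. *)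

(* Defs.v *)
From HB Require Import structures.
From mathcomp Require Import all_boot all_order all_algebra.
From mathcomp Require Import all_classical all_reals all_analysis.

Set Implicit Arguments.
Unset Strict Implicit.
Unset Printing Implicit Defensive.

Import Order.TTheory GRing.Theory Num.Theory.
Import numFieldNormedType.Exports.

Local Open Scope ring_scope.

(* [d k] : the coefficient of x^k in x (x+1) ... (x+d-1) *)
Definition stirling1 (d k : nat) : nat :=
  ((\prod_(i < d) ('X + (nat_of_ord i)%:P) : {poly nat})`_k)%R.

(* {k i} : the number of partitions of a k-element set into i nonempty blocks *)
Definition stirling2 (k i : nat) : nat :=
  #|[set P : {set {set 'I_k}} | finset.partition P [set: 'I_k] & #|P| == i]|.

Definition touchard (R : realType) (k : nat) : {poly R} :=
  \poly_(i < k.+1) (stirling2 k i)%:R.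

(* a (a+1) ... (a+n-1) *)
Definition rising_factorial (R : realType) (a : R) (n : nat) : R :=
  \prod_(i < n) (a + i%:R).

Definition kummer1F1 (R : realType) (a b z : R) : R :=
  limn (series (fun n : nat =>
    rising_factorial a n / rising_factorial b n * (z ^+ n / n`!%:R))).

(* f is d times continuously differentiable on the whole real line *)
Definition is_Cn (R : realType) (d : nat) (f : R -> R) : Prop :=
  (forall k : nat, (k < d)%N -> forall x : R, derivable (derive1n k f) x 1) /\
  continuous (derive1n d f).

Definition opD (R : realType) (f : R -> R) : R -> R := f^`()%classic.

Definition opX (R : realType) (f : R -> R) : R -> R := fun x => x * f x.

(* Meaningful away from 0 only: the library sets 0^-1 = 0. *)
Definition opXinv (R : realType) (f : R -> R) : R -> R := fun x => x^-1 * f x.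

Definition DS (R : realType) (d : nat) (f : R -> R) : R -> R := fun x =>
  \sum_(k < d) 'C(d.-1, k)%:R * (k.+1)`!%:R^-1
    * iter k (@opX R) (iter k.+1 (@opD R) f) x.

Definition DS' (R : realType) (d : nat) (f : R -> R) : R -> R := fun x =>
  d`!%:R^-1 * \sum_(k < d.+1) (stirling1 d k)%:R
    * opXinv (iter k (fun g => opX (opD g)) f) x.

(* Main.v *)
Require Import Defs.
From mathcomp Require Import all_boot.

Set Implicit Arguments.
Unset Strict Implicit.
Unset Printing Implicit Defensive.

(* Evaluate both operators at f = exp. Since every D^k exp = exp, D_{S_d} gives
   e^x times sum_k C(d-1,k) x^k / (k+1)!, which is the terminating series
   1F1(1-d; 2; -x); since (XD)^k exp = T_k exp, D_{S'_d} gives e^x times the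
   right-hand side. The identity for (XD)^k rests on T_(k+1) = x (T_k + T_k'),
   i.e. on the recurrence counting set partitions. *)

(** * Set partitions of a set with one extra element *)

Section PartitionU1.
Variables (T : finType) (a : T) (D : {set T}).
Implicit Types (P Q : {set {set T}}) (C : {set T}).
Hypothesis aD : a \notin D.

(* A partition of [a |: D] amounts to a partition [P] of [D] together with the
   block [C] of [P] that receives [a], where [C = set0] makes [a] a singleton. *)
Definition part_add (PC : {set {set T}} * {set T}) : {set {set T}} :=
  (a |: PC.2) |: PC.1 :\ PC.2.

(** The final [:\ set0] discards the empty remainder left when [a] forms a block by itself. *)
Definition part_rem Q : {set {set T}} * {set T} :=
  let B := pblock Q a in ((B :\ a |: Q :\ B) :\ set0, B :\ a).

Lemma part_add_notin P C : partition P D -> a |: C \notin P :\ C.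
Proof.
move=> partP; rewrite !inE negb_and; apply/orP; right; apply: contra aD => aC.
by apply: (subsetP (partitionS partP aC)); rewrite setU11.
Qed.

Lemma partition_add P C :
  partition P D -> C \in set0 |: P -> partition (part_add (P, C)) (a |: D).
Proof.
move=> partP CP; have partPC : partition (P :\ C) (D :\: C).
  case/setU1P: CP => [->|CP]; last exact: partitionD1.
  have /setDidPl -> : [disjoint P & [set set0]].
    by rewrite disjoint_sym disjoints1 (partition0 partP).
  by rewrite setD0.
have CD : C \subset D.
  by case/setU1P: CP => [->|/(partitionS partP)//]; rewrite sub0set.
(* Split off the new block: what remains is partitioned by [P :\ C]. *)
have -> : a |: D = (a |: C) :|: D :\: C.
  by rewrite -setUA; congr (_ |: _); rewrite -{1}(setID D C) (setIidPr CD).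
apply: partitionU1 => //.
  by apply/set0Pn; exists a; rewrite setU11.
rewrite -setI_eq0; apply/eqP/setP=> x; rewrite !inE.
case: eqVneq => [->|_] /=; first by rewrite (negPf aD) andbF.
by case: (x \in C).
Qed.

Lemma card_add P C : partition P D -> C \in set0 |: P ->
  #|part_add (P, C)| = #|P| + (C == set0).
Proof.
move=> partP CP; rewrite cardsU1 part_add_notin //= (cardsD1 C P).
case/setU1P: CP => [->|CP].
  by rewrite eqxx (partition0 partP) add0n addnC.
by rewrite CP (negPf (partition_neq0 partP CP)) addn0.
Qed.

Lemma part_addK P C : partition P D -> C \in set0 |: P ->
  part_rem (part_add (P, C)) = (P, C).
Proof.
move=> partP CP; have partQ := partition_add partP CP.
have aC : a \notin C.
  case/setU1P: CP => [->|/(partitionS partP)/subsetP CD]; first by rewrite inE.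
  by apply: contra aD => /CD.
rewrite /part_rem (@def_pblock _ _ (a |: C)) ?setU11 ?(partition_trivIset partQ) //.
rewrite /part_add /= !setU1K //; last exact: part_add_notin.
congr (_, _); case/setU1P: CP => [->|CP]; last first.
  by rewrite setD1K //; apply/setP=> E; rewrite !inE; case: eqVneq => // ->;
     rewrite (partition0 partP).
by apply/setP=> E; rewrite !inE; case: eqVneq => //= ->; rewrite (partition0 partP).
Qed.

Lemma part_rem_valid Q : partition Q (a |: D) ->
  partition (part_rem Q).1 D /\ (part_rem Q).2 \in set0 |: (part_rem Q).1.
Proof.
move=> partQ; have aQ : a \in cover Q by rewrite (cover_partition partQ) setU11.
have BQ := pblock_mem aQ; have aB : a \in pblock Q a by rewrite mem_pblock.
rewrite /part_rem /=; set B := pblock Q a in BQ aB *.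
have partQB := partitionD1 partQ BQ.
split; last by rewrite !inE eqxx andbT; case: eqVneq.
have BD : B :\ a \subset D.
  by rewrite subDset; apply: partitionS partQ BQ.
have DB : (a |: D) :\: B = D :\: (B :\ a).
  apply/setP=> x; rewrite !inE.
  by case: eqVneq => //= ->; rewrite aB (negPf aD).
(* If [a] is alone in its block, the other blocks already partition [D]; otherwise the shrunken
   block must be put back. *)
case: (eqVneq (B :\ a) set0) => [B0|Bn0].
  rewrite B0 setU1K ?(partition0 partQB) //.
  by rewrite DB B0 setD0 in partQB.
have -> : (B :\ a |: Q :\ B) :\ set0 = B :\ a |: Q :\ B.
  apply/setP=> E; rewrite !inE; case: eqVneq => //= ->.
  by rewrite eq_sym (negPf Bn0) (partition0 partQ) andbF.
have -> : D = B :\ a :|: (a |: D) :\: B.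
  by rewrite DB -{1}(setID D (B :\ a)) (setIidPr BD).
apply: partitionU1 => //.
by rewrite DB disjoint_sym disjoints_subset subsetDr.
Qed.

Lemma part_remK Q : partition Q (a |: D) -> part_add (part_rem Q) = Q.
Proof.
move=> partQ; have aQ : a \in cover Q by rewrite (cover_partition partQ) setU11.
have BQ := pblock_mem aQ; have aB : a \in pblock Q a by rewrite mem_pblock.
rewrite /part_rem /part_add /=; set B := pblock Q a in BQ aB *.
rewrite setD1K // -[RHS](setD1K BQ); congr (_ |: _).
apply/setP=> E; rewrite !inE.
case: (eqVneq E (B :\ a)) => /= [->|_]; last first.
  by case: eqVneq => //= ->; rewrite (partition0 partQ) andbF.
(* Were [B :\ a] itself a block of [Q], it would be nonempty and meet [B], so disjointness of blocks
   would force the two to be equal. *)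
apply/esym/negP => /andP[neB Q']; have [x xB] := set0Pn _ (partition_neq0 partQ Q').
have := def_pblock (partition_trivIset partQ) Q' xB.
rewrite (def_pblock (partition_trivIset partQ) BQ).
  by move=> E'; rewrite -E' eqxx in neB.
by move: xB; rewrite inE => /andP[].
Qed.

(** Group the partitions [Q] by the [P] they restrict to: [C = set0] creates one more block, and
    each of the [#|P|] other choices of [C] keeps the number of blocks. *)
Lemma big_partitionU1 (F : nat -> nat) :
  \sum_(Q | partition Q (a |: D)) F #|Q| =
  \sum_(P | partition P D) (F #|P|.+1 + #|P| * F #|P|).
Proof.
rewrite (reindex_onto part_add part_rem); last exact: part_remK.
transitivity (\sum_(PC | partition PC.1 D && (PC.2 \in set0 |: PC.1))
    F (#|PC.1| + (PC.2 == set0))).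
  apply: eq_big => [[P C]|[P C]] /=.
    apply/andP/andP => [[/part_rem_valid[]+ + /eqP PC]|[partP CP]].
      by rewrite PC.
    by rewrite partition_add // part_addK.
  case/andP=> /part_rem_valid[]+ + /eqP PC; rewrite PC /= => partP CP.
  by rewrite card_add.
rewrite -(pair_big_dep (fun P => partition P D) (fun P C => C \in set0 |: P)
  (fun P C => F (#|P| + (C == set0)))) /=.
apply: eq_bigr => P partP; rewrite big_setU1 ?(partition0 partP) //=.
rewrite eqxx addn1; congr (_ + _); rewrite -sum_nat_const.
by apply: eq_bigr => C CP; rewrite (negPf (partition_neq0 partP CP)) addn0.
Qed.
End PartitionU1.

(** * Recurrence for the Stirling numbers of the second kind *)

Fixpoint stirling2_rec (k i : nat) : nat :=
  match k, i with
  | 0, _ => (i == 0)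
  | k'.+1, 0 => 0
  | k'.+1, j.+1 => stirling2_rec k' j + j.+1 * stirling2_rec k' j.+1
  end%N.

(** Stated for a subset [D] of any finite type, rather than for all of ['I_k], so that the induction
    can delete a point without changing the ambient type. *)
Lemma card_partitions (T : finType) (D : {set T}) i :
  #|[set P | partition P D & #|P| == i]| = stirling2_rec #|D| i.
Proof.
have cardE (E : {set T}) j : #|[set P | partition P E & #|P| == j]| =
    (\sum_(P | partition P E) (#|P| == j))%N.
  rewrite -sum1_card [RHS]big_mkcond [LHS]big_mkcond; apply: eq_bigr => P _.
  by rewrite inE; case: (partition P E); case: (_ == j).
move: {2 3}#|D| (erefl #|D|) => k; elim: k => [|k IHk] in D i *.
  move/eqP; rewrite cards_eq0 => /eqP ->; rewrite cardE.
  rewrite (eq_bigl (pred1 set0)) => [|P]; last by rewrite partition_set0.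
  by rewrite big_pred1_eq cards0 eq_sym.
move=> cardD; have /card_gt0P[a aD] : (0 < #|D|)%N by rewrite cardD.
rewrite -(setD1K aD) cardE.
(* Counting is summation of the indicator of having [i] blocks. *)
rewrite (big_partitionU1 _ (fun m => nat_of_bool (m == i))) ?inE ?eqxx //.
have {}IHk := IHk (D :\ a) ^~ _.
have cardDa : #|(D :\ a)| = k by move: cardD; rewrite (cardsD1 a D) aD => -[].
case: i => [|i] /=.
  by rewrite big1 // => P _; case: #|P| => // n; rewrite muln0.
rewrite big_split /= -!IHk // !cardE; congr (_ + _)%N.
(* Where the indicator is nonzero, the weight [#|P|] equals [i.+1]. *)
rewrite big_distrr /=; apply: eq_bigr => P _.
by case: eqP => [->|]; rewrite ?muln0.
Qed.

Lemma stirling2_rec_small k i : (k < i)%N -> stirling2_rec k i = 0%N.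
Proof.
elim: k i => [|k IHk] [|i] //= ki.
by rewrite !IHk ?muln0 // ltnW.
Qed.

From mathcomp Require Import all_boot all_order all_algebra ring.
From mathcomp Require Import all_classical all_reals all_analysis.

Import Order.TTheory GRing.Theory Num.Theory.
Import numFieldNormedType.Exports.

Local Open Scope ring_scope.

(** * Both operators on the exponential *)

Lemma derive1_expR (R : realType) : (@expR R)^`()%classic = expR.
Proof. by apply/funext => x; rewrite derive1E derive_val. Qed.

Lemma derive1n_expR (R : realType) n : (@expR R)^`(n)%classic = expR.
Proof.
by elim: n => [|n IHn]; rewrite ?derive1n0 // derive1nS IHn derive1_expR.
Qed.

Lemma is_Cn_expR (R : realType) n : is_Cn n (@expR R).
Proof.
split=> [k _ x|]; rewrite derive1n_expR; first exact: derivable_expR.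
exact: continuous_expR.
Qed.

Lemma iter_opX (R : realType) k (g : R -> R) x : iter k (@opX R) g x = x ^+ k * g x.
Proof.
by elim: k => [|k IHk]; rewrite ?expr0 ?mul1r // iterS /opX IHk exprS mulrA.
Qed.

Lemma iter_opD_expR (R : realType) k : iter k (@opD R) expR = expR.
Proof. by elim: k => //= k ->; rewrite /opD derive1_expR. Qed.

Lemma DS_expR (R : realType) d (x : R) :
  DS d expR x = expR x * \sum_(k < d) 'C(d.-1, k)%:R / k.+1`!%:R * x ^+ k.
Proof.
rewrite mulr_sumr; apply: eq_bigr => k _.
by rewrite iter_opX iter_opD_expR mulrA [RHS]mulrC.
Qed.

(** By the product rule, XD acts on the polynomial factor as p -> x (p + p'), so iterating it stays
    within polynomials times exp. *)
Lemma opXD_poly_expR (R : realType) (p : {poly R}) :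
  opX (opD (fun y => p.[y] * expR y)) =
  (fun y => ('X * (p + p^`())).[y] * expR y).
Proof.
apply/funext => y; rewrite /opX /opD derive1E.
have D : is_derive y 1 (horner p * expR) (p.[y] *: expR y + expR y *: p^`().[y]).
  exact: is_deriveM.
rewrite (@derive_val _ _ _ _ _ _ _ D) hornerM hornerX hornerD -mulrA.
by rewrite mulrDl [p^`().[y] * _]mulrC.
Qed.

(** * The terminating Kummer series *)

Lemma rising_factorial_eqN (R : realType) n k :
  rising_factorial (- n%:R : R) k = (-1) ^+ k * (n ^_ k)%:R.
Proof.
elim: k => [|k IHk]; first by rewrite /rising_factorial big_ord0 expr0 mul1r.
rewrite /rising_factorial big_ord_recr /= -/(rising_factorial _ _) IHk.
rewrite ffactnSr natrM exprS.
(* For [k > n] the subtraction [n - k] in nat truncates, but the falling factorial is already 0. *)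
have [kn|kn] := leqP k n; first by rewrite natrB //; ring.
by rewrite ffact_small // !(mul0r, mulr0).
Qed.

Lemma rising_factorial2 (R : realType) k : rising_factorial (2 : R) k = k.+1`!%:R.
Proof.
elim: k => [|k IHk]; first by rewrite /rising_factorial big_ord0.
rewrite /rising_factorial big_ord_recr /= -/(rising_factorial _ _) IHk.
by rewrite -natrD add2n -natrM mulnC -factS.
Qed.

Lemma kummer1F1_polyE (R : realType) d (x : R) : (0 < d)%N ->
  kummer1F1 (1 - d%:R) 2 (- x) =
  \sum_(k < d) 'C(d.-1, k)%:R / k.+1`!%:R * x ^+ k.
Proof.
case: d => // n _; have -> : 1 - n.+1%:R = - n%:R :> R.
  by rewrite -natr1 opprD addrC subrK.
pose u k : R := 'C(n, k)%:R / k.+1`!%:R * x ^+ k.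
rewrite /kummer1F1 (_ : (fun _ => _) = u); last first.
  apply/funext => k; rewrite rising_factorial_eqN rising_factorial2.
  rewrite -bin_ffact natrM [(- x) ^+ k]exprNn /u.
  have fact0 m : m`!%:R != 0 :> R by rewrite pnatr_eq0 -lt0n fact_gt0.
  move: (fact0 k) (fact0 k.+1); move: k`!%:R k.+1`!%:R => a b a0 b0.
  (* The signs of the rising factorial and of [(- x) ^+ k] multiply to a square; writing 1 as that
     square lets [field] treat the sign [s] as an indeterminate. *)
  rewrite -[RHS]mul1r -[X in _ = X * _](sqrr_sign R k).
  move: ((-1) ^+ k) (x ^+ k) => s y.
  by field; rewrite a0 b0.
(* Binomials with [k > n] vanish, so the partial sums are constant from index [n.+1] on. *)
apply: norm_lim_near_cst; exists n.+1 => // m /= nm.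
rewrite seriesEnat /= (big_cat_nat (leq0n _) nm) //= big_mkord.
rewrite [X in _ + X]big_nat_cond [X in _ + X]big1 ?addr0 //.
move=> k /andP[/andP[nk _] _].
by rewrite /u bin_small // !mul0r.
Qed.

(** * Touchard polynomials and conclusion *)

Lemma stirling2E k i : stirling2 k i = stirling2_rec k i.
Proof. by rewrite /stirling2 card_partitions cardsT card_ord. Qed.

(** Valid beyond the degree too, since no partition of k points has more than k blocks; later
    coefficient comparisons thus need no bound on [i]. *)
Lemma coef_touchard (R : realType) k i : (touchard R k)`_i = (stirling2 k i)%:R.
Proof.
rewrite coef_poly ltnS; case: leqP => // ki.
by rewrite stirling2E stirling2_rec_small.
Qed.

Lemma touchard0 (R : realType) : touchard R 0 = 1.
Proof. by apply/polyP => i; rewrite coef_touchard stirling2E coef1. Qed.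

(** The coefficient of x^(i+1) on the right is {k i} + (i+1) {k i+1}, which is the recurrence for
    set partitions. *)
Lemma touchardS (R : realType) k :
  touchard R k.+1 = 'X * (touchard R k + (touchard R k)^`()).
Proof.
apply/polyP => -[|i]; rewrite coefXM coef_touchard stirling2E //=.
rewrite coefD coef_deriv !coef_touchard !stirling2E natrD natrM mulr_natl.
by [].
Qed.

Lemma iter_opXD_expR (R : realType) k :
  iter k (fun g => opX (opD g)) expR = (fun y : R => (touchard R k).[y] * expR y).
Proof.
elim: k => [|k IHk] /=; last by rewrite IHk opXD_poly_expR touchardS.
by apply/funext => y; rewrite touchard0 hornerC mul1r.
Qed.

Lemma DS'_expR (R : realType) d (x : R) :
  DS' d expR x = expR x *
    (x^-1 / d`!%:R * \sum_(k < d.+1) (stirling1 d k)%:R * (touchard R k).[x]).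
Proof.
rewrite /DS' 2!mulr_sumr [RHS]mulr_sumr; apply: eq_bigr => k _.
rewrite /opXinv iter_opXD_expR; move: (d`!%:R^-1) (x^-1) => a b; ring.
Qed.

Theorem mainTheorem1 (R : realType) (d : nat) (hd : (1 <= d)%N)
    (hDS : forall f : R -> R, is_Cn d f ->
      forall x : R, x != 0 -> DS d f x = DS' d f x)
    (x : R) (hx : x != 0) :
  kummer1F1 (1 - d%:R) 2%:R (- x) =
    x^-1 / d`!%:R * \sum_(k < d.+1) (stirling1 d k)%:R * (touchard R k).[x].
Proof.
rewrite kummer1F1_polyE //; have := hDS _ (is_Cn_expR R d) x hx.
(* Both sides carry the factor e^x, which is positive and cancels. *)
by rewrite DS_expR DS'_expR => /(mulfI (lt0r_neq0 (expR_gt0 x))).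
Qed.
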